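(* Let $w(z)=e^z$, and let $n\ge0$ and $r\ge0$ be integers. Then the polynomials $P_n(z;r)$ and $Q_n(z;r)$ associated with $w$ are $$P_n(z;r)=2^n\sum_{\ell=0}^n\frac{1}{\ell!}\sum_{m=0}^\ell(-1)^{m+n+\ell}\binom{\ell}{m}\left(\frac{r-m}{2}\right)_n z^\ell,$$ $$Q_n(z;r)=\frac{(-1)^n}{4^n\left(\frac{r+1}{2}\right)_n\left(\frac{r+2}{2}\right)_n}\;{}_3F_0\!\left(-n,\tfrac{r+1}{2},\tfrac{r+2}{2};;4z\right).$$
   Context: $\mathbb{T}$ is the unit circle, oriented counterclockwise. For $w(z)=e^z$ the Fourier coefficients are $w_k=\int_{\mathbb{T}}\zeta^{-k}e^{\zeta}\frac{d\zeta}{2\pi i\zeta}=1/\Gamma(k+1)$ ($=0$ for $k<0$). The determinants $D_n^{(r)}=\det(w_{r+2j-k})_{0\le j,k\le n-1}$ are non-zero for all integers $n\ge1$, $r\ge0$. $P_n(z;r)$ and $Q_n(z;r)$ are the unique monic polynomials of degree $n$ with $\int_{\mathbb{T}}P_n(\zeta;r)\zeta^{-2m-r}w(\zeta)\frac{d\zeta}{2\pi i\zeta}=0$ and $\int_{\mathbb{T}}Q_n(\zeta^{-2};r)\zeta^{m-r}w(\zeta)\frac{d\zeta}{2\pi i\zeta}=0$ for $0\le m\le n-1$. $(a)_n=a(a+1)\cdots(a+n-1)$, $(a)_0=1$, is the rising factorial, and ${}_3F_0(a,b,c;;x)=\sum_{\ell\ge0}\frac{(a)_\ell(b)_\ell(c)_\ell}{\ell!}x^\ell$,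 a finite sum when $a=-n$. *)

(* Defs.v *)
From HB Require Import structures.
From mathcomp Require Import all_boot all_order all_algebra.
From mathcomp Require Import all_classical all_reals all_analysis.
From mathcomp Require Import complex.
Import Order.TTheory GRing.Theory Num.Theory.
Import numFieldNormedType.Exports.

Set Implicit Arguments.
Unset Strict Implicit.
Unset Printing Implicit Defensive.

Local Open Scope classical_set_scope.
Local Open Scope ring_scope.
Local Open Scope complex_scope.

Definition expC {R : realType} (z : R[i]) : R[i] :=
  (expR (complex.Re z))%:C
  * (cos (complex.Im z) +i* sin (complex.Im z)).

(* Integral over [a, b] of a complex-valued function of a real variable. *)
Definition cintegral {R : realType} (a b : R) (f : R -> R[i]) : R[i] :=
  (\int[@lebesgue_measure R]_(t in `[a, b]) complex.Re (f t))
  +i* (\int[@lebesgue_measure R]_(t in `[a, b]) complex.Im (f t)).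

(* Contour integral of f(zeta) d zeta over the counterclockwise unit circle,
   zeta = expC(i t), d zeta = i zeta dt, 0 <= t <= 2 pi. *)
Definition circle_integral {R : realType} (f : R[i] -> R[i]) : R[i] :=
  cintegral 0 (2 * pi)
    (fun t => let zeta := expC ('i * t%:C) in f zeta * ('i * zeta)).

(* Integral of f(zeta) d zeta / (2 pi i zeta) over the unit circle. *)
Definition circle_mean {R : realType} (f : R[i] -> R[i]) : R[i] :=
  circle_integral (fun zeta => f zeta / (2 * pi%:C * 'i * zeta)).

(* The properties that define P_n(z;r) and Q_n(z;r) for the weight w.
   Recall that a polynomial of degree n has size n.+1. *)
Definition is_P {R : realType} (w : R[i] -> R[i]) (n r : nat)
    (p : {poly R[i]}) : Prop :=
  [/\ p \is monic, size p = n.+1 &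
    forall m : nat, (m < n)%N ->
      circle_mean
        (fun zeta => p.[zeta] * zeta ^ (- 2 * m%:Z - r%:Z) * w zeta) = 0].

Definition is_Q {R : realType} (w : R[i] -> R[i]) (n r : nat)
    (q : {poly R[i]}) : Prop :=
  [/\ q \is monic, size q = n.+1 &
    forall m : nat, (m < n)%N ->
      circle_mean
        (fun zeta => q.[zeta ^- 2] * zeta ^ (m%:Z - r%:Z) * w zeta) = 0].

Definition rising {K : numFieldType} (a : K) (n : nat) : K :=
  \prod_(i < n) (a + i%:R).

(* The sum of the series, meaningful when it terminates (one of a, b, c is a
   non-positive integer) or x = 0; limn returns a junk value on divergence. *)
Definition hyp3F0 {K : numFieldType} (a b c x : K) : K :=
  limn (series (fun l : nat =>
    rising a l * rising b l * rising c l / l`!%:R * x ^+ l)).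

(* Main.v *)
(** Integrating the derivative of e^{ikt} exp(e^{it}) over a period shows that
    the moments M_k, the means of zeta^k e^zeta, satisfy M_{k+1} = - k M_k.
    Hence M_{l-x} = M_0 x(x-1)...(x-l+1) / x! for naturals l and x, and only
    M_0 <> 0 is needed, which holds because Re exp(e^{it}) > 0.

    The orthogonality of P = sum_l p_l z^l therefore says that the polynomial
    with coefficients p_l in the basis of falling factorials vanishes at
    r, r+2, ..., r+2(n-1).  Being monic of degree n it is the product of the
    x - r - 2j, and Newton's forward difference formula recovers the p_l.

    The orthogonality of Q = sum_l q_l z^l says that the weights
    q_l / (2l+r)! annihilate every polynomial in l of degree < n, so they are
    proportional to (-1)^l binomial(n, l), the weights of the n-th difference. *)

Require Import Defs.
From mathcomp Require Import all_boot all_order all_algebra.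
From mathcomp Require Import all_classical all_reals all_analysis.
From mathcomp Require Import complex.
From mathcomp Require Import ring.
Import Order.TTheory GRing.Theory Num.Theory.
Import numFieldNormedType.Exports.

Set Implicit Arguments.
Unset Strict Implicit.
Unset Printing Implicit Defensive.

Local Open Scope classical_set_scope.
Local Open Scope ring_scope.
Local Open Scope complex_scope.

(** * Moments of the exponential on the unit circle *)

Section Analysis.
Variable R : realType.
Implicit Types (f F : R -> R) (t : R) (k : int).

Definition cis (t : R) : R[i] := cos t +i* sin t.

Lemma cisD (s t : R) : cis (s + t) = cis s * cis t.
Proof.
rewrite /cis sinD cosD; simpc.
by congr (_ +i* _); rewrite addrC.
Qed.

Lemma real_complexM (a x y : R) : a%:C * (x +i* y) = (a * x) +i* (a * y).
Proof. by simpc. Qed.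

Lemma cis0 : cis 0 = 1.
Proof. by rewrite /cis cos0 sin0. Qed.

Lemma cis2pi : cis (2 * pi) = 1.
Proof. by rewrite /cis mulr_natl cos2pi sin2pi. Qed.

Lemma cis_neq0 t : cis t != 0.
Proof.
apply/eqP => c0; have := oner_neq0 R[i].
by rewrite -cis0 -(subrr t) cisD c0 mul0r eqxx.
Qed.

Lemma cisN t : cis (- t) = (cis t)^-1.
Proof.
apply: (mulIf (cis_neq0 t)).
by rewrite mulVf ?cis_neq0 // -cisD addNr cis0.
Qed.

Lemma cis_exprz t k : cis t ^ k = cis (k%:~R * t).
Proof.
have cisX n : cis t ^+ n = cis (n%:R * t).
  elim: n => [|n IH]; first by rewrite mul0r cis0.
  by rewrite exprS IH -cisD -addn1 natrD mulrDl mul1r addrC.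
case: k => n; first by rewrite -exprnP cisX.
by rewrite NegzE -exprnN cisX -cisN mulrNz mulNr.
Qed.

Lemma expC_cis t : expC ('i * t%:C) = cis t.
Proof.
have -> : ('i : R[i]) * t%:C = 0 +i* t.
  by rewrite -complexiE /GRing.mul /= !mul0r !mul1r subrr add0r.
by rewrite /expC /= expR0 mul1r.
Qed.

Lemma expC_exp_cis t : expC (cis t) = (expR (cos t))%:C * cis (sin t).
Proof. by []. Qed.

(** Supplies the continuity at the endpoints that the fundamental theorem of calculus asks of a
    primitive. *)
Lemma continuous_is_derive F f : (forall t, is_derive t 1 F (f t)) -> continuous F.
Proof.
move=> dF t; apply: differentiable_continuous; apply/derivable1_diffP.
exact: (@ex_derive _ _ _ _ _ _ _ (dF t)).
Qed.

Lemma Rintegral_is_derive (a b : R) F f : a < b ->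
    (forall t, is_derive t 1 F (f t)) -> continuous f ->
  \int[lebesgue_measure]_(t in `[a, b]) f t = F b - F a.
Proof.
move=> ab dF cf.
rewrite /Rintegral (@continuous_FTC2 _ f F) //.
- exact: continuous_subspaceT.
- split; first by move=> x _; apply: (@ex_derive _ _ _ _ _ _ _ (dF x)).
  + by apply: cvg_at_right_filter; apply: (continuous_is_derive dF).
  + by apply: cvg_at_left_filter; apply: (continuous_is_derive dF).
- by move=> t _; rewrite derive1E; apply: (@derive_val _ _ _ _ _ _ _ (dF t)).
Qed.

(* Real and imaginary parts of e^{iat} exp(e^{it}). *)
Definition ecos (a t : R) : R := expR (cos t) * cos (a * t + sin t).
Definition esin (a t : R) : R := expR (cos t) * sin (a * t + sin t).

(** With E_a(t) = e^{iat} exp(e^{it}) one has E_a' = i (a E_a + E_{a+1}). This is the real part of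
    that identity, and the next lemma is its imaginary part. *)
Lemma is_derive_ecos (a t : R) :
  is_derive t 1 (ecos a) (- (a * esin a t + esin (a + 1) t)).
Proof.
rewrite /ecos; apply: is_derive_eq.
rewrite /esin (_ : (a + 1) * t + sin t = t + (a * t + sin t)); last by ring.
by rewrite sinD /GRing.scale /=; ring.
Qed.

Lemma is_derive_esin (a t : R) :
  is_derive t 1 (esin a) (a * ecos a t + ecos (a + 1) t).
Proof.
rewrite /esin; apply: is_derive_eq.
rewrite /ecos (_ : (a + 1) * t + sin t = t + (a * t + sin t)); last by ring.
by rewrite cosD /GRing.scale /=; ring.
Qed.

Lemma continuous_ecos (a : R) : continuous (ecos a).
Proof. exact: continuous_is_derive (is_derive_ecos a). Qed.

Lemma continuous_esin (a : R) : continuous (esin a).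
Proof. exact: continuous_is_derive (is_derive_esin a). Qed.

(** Continuity is taken componentwise to match [cintegral], which integrates the two real components
    separately. *)
Definition ccontinuous (f : R -> R[i]) :=
  continuous (fun t => complex.Re (f t)) /\ continuous (fun t => complex.Im (f t)).

Lemma ccontinuousD (f g : R -> R[i]) :
  ccontinuous f -> ccontinuous g -> ccontinuous (fun t => f t + g t).
Proof.
case=> fr fi [gr gi]; split=> t.
- rewrite (_ : (fun _ => _) = (fun t => complex.Re (f t) + complex.Re (g t))).
    by apply: continuousD; [exact: fr|exact: gr].
  by apply/funext => s; case: (f s) (g s) => ? ? [].
- rewrite (_ : (fun _ => _) = (fun t => complex.Im (f t) + complex.Im (g t))).
    by apply: continuousD; [exact: fi|exact: gi].
  by apply/funext => s; case: (f s) (g s) => ? ? [].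
Qed.

Lemma ccontinuousZ (a : R[i]) (f : R -> R[i]) :
  ccontinuous f -> ccontinuous (fun t => a * f t).
Proof.
case: a => x y [fr fi]; split=> t.
- rewrite (_ : (fun _ => _) = (fun t => x * complex.Re (f t) + (- y) * complex.Im (f t))).
    apply: cvgD; (apply: cvgM; first exact: cvg_cst).
      exact: fr.
    exact: fi.
  by apply/funext => s; rewrite mulNr; case: (f s).
- rewrite (_ : (fun _ => _) = (fun t => x * complex.Im (f t) + y * complex.Re (f t))).
    apply: cvgD; (apply: cvgM; first exact: cvg_cst).
      exact: fi.
    exact: fr.
  by apply/funext => s; case: (f s).
Qed.

(** * Linearity of the complex integral *)

Lemma continuous_itv_integrable (a b : R) f : continuous f ->
  lebesgue_measure.-integrable `[a, b] (EFin \o f).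
Proof.
move=> cf; apply: continuous_compact_integrable; first exact: segment_compact.
exact: continuous_subspaceT.
Qed.

Lemma cintegralD (a b : R) (f g : R -> R[i]) : ccontinuous f -> ccontinuous g ->
  cintegral a b (fun t => f t + g t) = cintegral a b f + cintegral a b g.
Proof.
case=> fr fi [gr gi]; rewrite /cintegral.
rewrite -[RHS]/(_ +i* _); congr (_ +i* _).
- rewrite -RintegralD //; try exact: continuous_itv_integrable.
  by apply: eq_Rintegral => t _; case: (f t) (g t) => ? ? [].
- rewrite -RintegralD //; try exact: continuous_itv_integrable.
  by apply: eq_Rintegral => t _; case: (f t) (g t) => ? ? [].
Qed.

Lemma continuous_mull (x : R) f : continuous f -> continuous (fun t => x * f t).
Proof. by move=> cf t; apply: cvgM; [exact: cvg_cst|exact: cf]. Qed.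

Lemma cintegralZ (a b : R) (c : R[i]) (f : R -> R[i]) : ccontinuous f ->
  cintegral a b (fun t => c * f t) = c * cintegral a b f.
Proof.
case: c => x y [fr fi]; rewrite /cintegral -[RHS]/(_ +i* _).
rewrite -!RintegralZl //; try exact: continuous_itv_integrable.
congr (_ +i* _).
- rewrite -RintegralB //; try exact/continuous_itv_integrable/continuous_mull.
  by apply: eq_Rintegral => t _; case: (f t).
- rewrite -RintegralD //; try exact/continuous_itv_integrable/continuous_mull.
  by apply: eq_Rintegral => t _; case: (f t).
Qed.

Lemma cintegral_sum (a b : R) n (c : 'I_n -> R[i]) (f : 'I_n -> R -> R[i]) :
  (forall l, ccontinuous (f l)) ->
  cintegral a b (fun t => \sum_(l < n) c l * f l t)
  = \sum_(l < n) c l * cintegral a b (f l).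
Proof.
move=> cf; have ccf l : ccontinuous (fun t => c l * f l t) by exact: ccontinuousZ.
(* Continuity of the partial sums is carried through the induction, because [cintegralD] asks for it
   at each step. *)
suff [] : ccontinuous (fun t => \sum_(l < n) c l * f l t) /\
  cintegral a b (fun t => \sum_(l < n) c l * f l t)
    = \sum_(l < n) c l * cintegral a b (f l) by [].
elim: n c f cf ccf => [|n IH] c f cf ccf.
  rewrite big_ord0; under eq_fun do rewrite big_ord0.
  split; first by split=> t; exact: cvg_cst.
  by rewrite /cintegral /= Rintegral_cst // mul0r.
rewrite big_ord_recl; under eq_fun do rewrite big_ord_recl.
have [|cI IHe] := IH (c \o lift ord0) (f \o lift ord0) (fun l => cf _).
  by move=> l; exact: ccf.
by split; [exact: ccontinuousD|rewrite cintegralD // cintegralZ // IHe].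
Qed.

(** * Moments: recurrence, positivity and closed form *)

Definition moment k : R[i] := circle_mean (fun zeta => zeta ^ k * expC zeta).

(** The factor i zeta of d zeta cancels the one in the denominator of the mean. *)
Lemma circle_meanE (f : R[i] -> R[i]) :
  circle_mean f = cintegral 0 (2 * pi) (fun t => f (cis t) / (2 * pi)%:C).
Proof.
rewrite /circle_mean /circle_integral /=; congr cintegral; apply/funext => t.
rewrite expC_cis -mulrA; congr (_ * _).
have i0 : ('i : R[i]) != 0 by exact: neq0Ci.
by rewrite -(mulrA (2 * _)) invfM -mulrA mulVf ?mulr1 ?mulf_neq0 ?cis_neq0 ?rmorphM ?rmorphMn.
Qed.

Lemma cis_expC k t : cis t ^ k * expC (cis t) =
  ecos k%:~R t +i* esin k%:~R t.
Proof.
rewrite cis_exprz expC_exp_cis mulrCA -cisD /cis /ecos /esin.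
by simpc.
Qed.

Lemma ccontinuous_cis_expC k :
  ccontinuous (fun t => cis t ^ k * expC (cis t)).
Proof.
split=> t; under eq_fun do rewrite cis_expC /=.
- exact: continuous_ecos.
- exact: continuous_esin.
Qed.

Lemma moment_cintegral k : moment k =
  (2 * pi)%:C^-1 * cintegral 0 (2 * pi) (fun t => cis t ^ k * expC (cis t)).
Proof.
rewrite /moment circle_meanE; under eq_fun do rewrite mulrC.
exact/cintegralZ/ccontinuous_cis_expC.
Qed.

Lemma momentE k : moment k = (2 * pi)%:C^-1 *
  ((\int[lebesgue_measure]_(t in `[0, 2 * pi]) ecos k%:~R t)
   +i* (\int[lebesgue_measure]_(t in `[0, 2 * pi]) esin k%:~R t)).
Proof.
rewrite moment_cintegral; congr (_ * (_ +i* _)).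
- by apply: eq_Rintegral => t _; rewrite cis_expC.
- by apply: eq_Rintegral => t _; rewrite cis_expC.
Qed.

(** Reduces the mean of a Laurent polynomial times e^z to moments. Equality is asked only at z != 0,
    where negative powers can be combined. *)
Lemma circle_mean_sum n (c : 'I_n -> R[i]) (k : 'I_n -> int) (f : R[i] -> R[i]) :
  (forall z, z != 0 -> f z = (\sum_(l < n) c l * z ^ k l) * expC z) ->
  circle_mean f = \sum_(l < n) c l * moment (k l).
Proof.
move=> fE; rewrite circle_meanE.
under eq_fun => t.
  rewrite fE ?cis_neq0 // mulr_suml mulr_suml.
  under eq_bigr => l _ do rewrite -(mulrA (c l)) mulrAC.
over.
rewrite (cintegral_sum _ _ _ (fun l => ccontinuous_cis_expC (k l))).
by apply: eq_bigr => l _; rewrite moment_cintegral mulrA.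
Qed.

(** Integrating E_k' = i (k E_k + E_{k+1}) over a period gives 0 = k M_k + M_{k+1}. *)
Lemma moment_rec k : moment (k + 1) = - k%:~R * moment k.
Proof.
have pi2 : 0 < 2 * pi :> R by rewrite mulr_gt0 ?pi_gt0.
(* The boundary values agree because [k] is an integer: E_k is then a function of [cis t] alone. *)
have C0 : ecos k%:~R (2 * pi) +i* esin k%:~R (2 * pi) = ecos k%:~R 0 +i* esin k%:~R 0.
  by rewrite -!cis_expC cis2pi cis0.
have [Ec Es] : ecos k%:~R (2 * pi) = ecos k%:~R 0 /\ esin k%:~R (2 * pi) = esin k%:~R 0.
  by case: C0.
have cfg a b (f g : R -> R) : continuous f -> continuous g ->
    continuous (fun t => a * f t + b * g t).
  by move=> cf cg t; apply: cvgD; [exact: continuous_mull cf t|exact: continuous_mull cg t].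
have I0 (a b : R) f g F : continuous f -> continuous g ->
    (forall t, is_derive t 1 F (a * f t + b * g t)) -> F (2 * pi) = F 0 ->
    a * (\int[lebesgue_measure]_(t in `[0, 2 * pi]) f t)
    + b * (\int[lebesgue_measure]_(t in `[0, 2 * pi]) g t) = 0.
  move=> cf cg dF F0; have := Rintegral_is_derive pi2 dF (cfg _ _ _ _ cf cg).
  rewrite RintegralD //; try exact/continuous_itv_integrable/continuous_mull.
  by rewrite !RintegralZl ?F0 ?subrr //; exact: continuous_itv_integrable.
(* The derivative of [esin] yields the real part of the recurrence, that of [ecos] the imaginary
   part. *)
have Ic := I0 k%:~R 1 (ecos k%:~R) (ecos (k%:~R + 1)) (esin k%:~R)
  (@continuous_ecos _) (@continuous_ecos _) _ Es.
have Is := I0 (- k%:~R) (- 1) (esin k%:~R) (esin (k%:~R + 1)) (ecos k%:~R)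
  (@continuous_esin _) (@continuous_esin _) _ Ec.
rewrite !momentE mulrCA; congr (_ * _).
have -> : - k%:~R = (- k%:~R)%:C :> R[i] by rewrite rmorphN /= rmorph_int.
rewrite intrD mulr1z real_complexM; congr (_ +i* _).
- apply/eqP; rewrite -subr_eq0 mulNr opprK addrC -[X in _ + X]mul1r; apply/eqP; apply: Ic.
  by move=> t; rewrite mul1r; exact: is_derive_esin.
- apply/eqP; rewrite eq_sym -subr_eq0 -[X in _ + X]mulN1r; apply/eqP; apply: Is.
  by move=> t; rewrite mulN1r mulNr -opprD; exact: is_derive_ecos.
Qed.

(** The integrand e^{cos t} cos(sin t) is at least e^{-1} cos 1 > 0, since cos t >= -1 and |sin t|
    <= 1. *)
Lemma Re_moment0_gt0 : 0 < complex.Re (moment 0).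
Proof.
have pi2 : 0 < 2 * pi :> R by rewrite mulr_gt0 ?pi_gt0.
rewrite momentE -fmorphV real_complexM /=.
rewrite mulr_gt0 ?invr_gt0 //.
(* The cosine is even, and decreasing on [0, pi], which contains 1. *)
have cos1_le (u : R) : `|u| <= 1 -> cos 1 <= cos u.
  have -> : cos u = cos `|u| by case: (ger0P u) => _; rewrite ?cosN.
  move=> u1; have pi1 : 1 <= pi :> R by rewrite (le_trans _ (pi_ge2 R)) // ler1n.
  rewrite leNgt ltr_cos -?leNgt // in_itv /= ?ler01 ?pi1 //.
  by rewrite normr_ge0 (le_trans u1).
have lb t : expR (-1) * cos 1 <= ecos 0%:~R t.
  rewrite /ecos mul0r add0r ler_pM ?expR_ge0 ?(ltW (cos1_gt0 _)) //.
    by rewrite ler_expR cos_geN1.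
  exact/cos1_le/sin_max.
have lbI : \int[lebesgue_measure]_(t in `[0, 2 * pi]) (expR (-1) * cos 1)
    <= \int[lebesgue_measure]_(t in `[0, 2 * pi]) ecos 0%:~R t.
  apply: le_Rintegral => //.
  - by apply: continuous_itv_integrable => t; exact: cvg_cst.
  - exact/continuous_itv_integrable/continuous_ecos.
apply: lt_le_trans lbI.
rewrite Rintegral_cst //= lebesgue_measure_itv /= lte_fin pi2 /= subr0.
by rewrite !mulr_gt0 ?expR_gt0 ?cos1_gt0 ?pi_gt0.
Qed.

Lemma moment_ffact l x :
  moment (l%:Z - x%:Z) = moment 0 * (x ^_ l)%:R / x`!%:R.
Proof.
have fact_neq0 n : n`!%:R != 0 :> R[i] by rewrite pnatr_eq0 -lt0n fact_gt0.
case: (leqP l x) => [lx|xl].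
  have momentN d : moment (- d%:Z) = moment 0 / d`!%:R.
    elim: d => [|d IH]; first by rewrite oppr0 divr1.
    have d0 : d.+1%:R != 0 :> R[i] by rewrite pnatr_eq0.
    (* At k = -(d+1) the recurrence reads M_{-d} = (d+1) M_{-(d+1)}. *)
    apply: (mulfI d0); have := moment_rec (- d.+1%:Z).
    rewrite -{1}addn1 PoszD opprD subrK IH mulrNz opprK => <-.
    by rewrite factS natrM invfM mulrCA (mulVKf d0).
  rewrite -opprB subzn // momentN -(ffact_fact lx) natrM invfM.
  rewrite [RHS]mulrA mulfK //.
  by rewrite pnatr_eq0 -lt0n ffact_gt0.
(* Now l > x. The falling factorial vanishes, and so do all moments of positive index, starting from
   M_1 = -0 M_0 = 0. *)
rewrite ffact_small // mulr0 mul0r.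
have -> : l%:Z - x%:Z = (l - x).-1%:Z + 1.
  by rewrite -PoszD addn1 prednK ?subn_gt0 // subzn // ltnW.
elim: (l - x).-1 => [|d IH]; rewrite moment_rec ?oppr0 ?mul0r //.
by rewrite -addn1 PoszD IH mulr0.
Qed.
End Analysis.

(** * Newton interpolation and the algebraic form of the orthogonality relations *)

Section Newton.
Variable K : numFieldType.
Implicit Types (p f g : {poly K}) (k l n x : nat).

Definition ffact_poly k : {poly K} := \prod_(i < k) ('X - i%:R%:P).

Lemma ffact_poly_monic k : ffact_poly k \is monic.
Proof. exact: monic_prod_XsubC. Qed.

Lemma size_ffact_poly k : size (ffact_poly k) = k.+1.
Proof. by rewrite size_prod_XsubC /index_enum -enumT size_enum_ord. Qed.

Lemma horner_ffact_poly k x : (ffact_poly k).[x%:R] = (x ^_ k)%:R.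
Proof.
elim: k => [|k IH]; first by rewrite /ffact_poly big_ord0 hornerC.
rewrite /ffact_poly big_ord_recr /= hornerM IH !hornerE ffactnSr natrM.
case: (leqP k x) => [kx|xk]; first by rewrite natrB.
by rewrite ffact_small // !mul0r.
Qed.

(** The linear map sending z^l to the falling factorial x(x-1)...(x-l+1). It turns the orthogonality
    integrals of P into point evaluations. *)
Definition newton p : {poly K} := \sum_(l < size p) p`_l *: ffact_poly l.

Lemma newtonE n p : (size p <= n)%N -> newton p = \sum_(l < n) p`_l *: ffact_poly l.
Proof.
move=> pn; rewrite /newton (big_ord_widen n (fun l => p`_l *: ffact_poly l) pn).
rewrite big_mkcond /=; apply: eq_bigr => l _.
by case: ltnP => // /leq_sizeP/(_ l (leqnn _)) ->; rewrite scale0r.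
Qed.

Lemma size_sum_ffact n (a : nat -> K) :
  (size (\sum_(l < n) a l *: ffact_poly l)%R <= n)%N.
Proof.
apply: (leq_trans (size_sum _ _ _)); apply/bigmax_leqP => l _.
by apply: (leq_trans (size_scale_leq _ _)); rewrite size_ffact_poly.
Qed.

(** The map is unitriangular: the falling factorials of order below n do not reach degree n, and the
    one of order n is monic. *)
Lemma coef_newton n p : (size p <= n.+1)%N -> (newton p)`_n = p`_n.
Proof.
move=> pn; rewrite (newtonE pn) big_ord_recr /= coefD coefZ.
have /monicP := ffact_poly_monic n; rewrite /lead_coef size_ffact_poly /= => ->.
by rewrite mulr1 nth_default ?add0r // size_sum_ffact.
Qed.

Lemma size_newton p : (size (newton p) <= size p)%N.
Proof. exact: size_sum_ffact. Qed.

Lemma newton_monic n p : p \is monic -> size p = n.+1 ->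
  newton p \is monic /\ size (newton p) = n.+1.
Proof.
move=> /monicP; rewrite /lead_coef => + sp; rewrite sp /= => pn.
have cn : (newton p)`_n = 1 by rewrite coef_newton ?sp.
have sn : size (newton p) = n.+1.
  apply/eqP; rewrite eqn_leq -{1}sp size_newton /=.
  rewrite ltnNge; apply/negP => /leq_sizeP/(_ n (leqnn _))/eqP.
  by rewrite cn oner_eq0.
by split=> //; apply/monicP; rewrite /lead_coef sn.
Qed.

(** By triangularity: subtracting g_n times the n-th falling factorial lowers the degree, and the
    induction handles the rest. *)
Lemma newton_surj n g : (size g <= n)%N -> exists2 p : {poly K}, (size p <= n)%N & newton p = g.
Proof.
elim: n g => [|n IH] g gn.
  exists 0; first by rewrite size_poly0.
  move: gn; rewrite leqn0 size_poly_eq0 => /eqP ->.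
  by rewrite /newton size_poly0 big_ord0.
have [|p pn hp] := IH (g - g`_n *: ffact_poly n).
  apply/leq_sizeP => j; rewrite leq_eqVlt => /predU1P [<-|nj].
    rewrite coefB coefZ.
    have /monicP := ffact_poly_monic n; rewrite /lead_coef size_ffact_poly /= => ->.
    by rewrite mulr1 subrr.
  rewrite coefB coefZ (nth_default _ (leq_trans gn nj)) sub0r.
  by rewrite [X in _ * X]nth_default ?size_ffact_poly // mulr0 oppr0.
exists (p + g`_n *: 'X^n).
  apply: (leq_trans (size_polyD _ _)); rewrite geq_max (leq_trans pn) //=.
  by apply: (leq_trans (size_scale_leq _ _)); rewrite size_polyXn.
rewrite (@newtonE n.+1); last first.
  apply: (leq_trans (size_polyD _ _)); rewrite geq_max (leq_trans pn) //=.
  by apply: (leq_trans (size_scale_leq _ _)); rewrite size_polyXn.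
rewrite big_ord_recr /= coefD coefZ coefXn eqxx mulr1 (nth_default _ pn) add0r.
apply/eqP; rewrite -subr_eq0 -addrA; apply/eqP.
rewrite -[X in _ + X]opprB -hp (newtonE pn); apply/eqP; rewrite subr_eq0; apply/eqP.
apply: eq_bigr => l _; rewrite coefD coefZ coefXn (ltn_eqF (ltn_ord l)).
by rewrite mulr0 addr0.
Qed.

(** The l-th forward difference of f at 0. The exponent m + l has the parity of l - m and avoids
    subtraction. *)
Definition fdiff l (f : nat -> K) : K :=
  \sum_(m < l.+1) (-1) ^+ (m + l) * 'C(l, m)%:R * f m.

Lemma fdiffS l (f : nat -> K) : fdiff l.+1 f = fdiff l (fun m => f m.+1 - f m).
Proof.
rewrite /fdiff; under [RHS]eq_bigr do rewrite mulrBr.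
rewrite sumrB big_ord_recl [in X in _ - X]big_ord_recl /=.
under [in LHS]eq_bigr => i _.
  rewrite /bump /= binS natrD mulrDr mulrDl.
over.
rewrite big_split /= bin0 !bin0 !add0n.
have -> : \sum_(i < l.+1) (-1) ^+ (1 + i + l.+1) * 'C(l, i)%:R * f (1 + i)%N
   = \sum_(i < l.+1) (-1) ^+ (i + l) * 'C(l, i)%:R * f i.+1.
  by apply: eq_bigr => i _; rewrite !addnS !add1n !exprS; ring.
rewrite big_ord_recr /= bin_small // mulr0 mul0r addr0.
have -> : \sum_(i < l) (-1) ^+ (1 + i + l.+1) * 'C(l, 1 + i)%:R * f (1 + i)%N
   = - \sum_(i < l) (-1) ^+ (1 + i + l) * 'C(l, 1 + i)%:R * f (1 + i)%N.
  by rewrite -sumrN; apply: eq_bigr => i _; rewrite !addnS !exprS; ring.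
rewrite exprS; ring.
Qed.

Lemma eq_fdiff l (f g : nat -> K) : f =1 g -> fdiff l f = fdiff l g.
Proof. by move=> fg; apply: eq_bigr => i _; rewrite fg. Qed.

Lemma fdiffZ l (a : K) (f : nat -> K) : fdiff l (fun m => a * f m) = a * fdiff l f.
Proof. by rewrite /fdiff mulr_sumr; apply: eq_bigr => i _; ring. Qed.

(** The difference of the falling factorial of order k+1 is (k+1) times that of order k. After l
    steps only l = k leaves a nonzero value at 0. *)
Lemma fdiff_ffact l k : fdiff l (fun x => (x ^_ k)%:R) = (l == k)%:R * l`!%:R.
Proof.
elim: l k => [|l IH] k.
  rewrite /fdiff big_ord1 /= bin0 mulr1 expr0 mul1r mulr1.
  by case: k => // k; rewrite ffact_small.
rewrite fdiffS; case: k => [|k].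
  by rewrite mul0r [LHS]big1 // => m _; rewrite !ffactn0 subrr mulr0.
rewrite (@eq_fdiff _ _ (fun x => k.+1%:R * (x ^_ k)%:R)) => [|x].
  rewrite fdiffZ IH eqSS factS natrM.
  by case: eqP => [->|]; rewrite ?mul0r ?mulr0 // !mul1r.
rewrite ffactSS ffactnSr -!natrM.
(* The natural subtraction x - k from [ffactnSr] is exact only for k <= x; otherwise both sides are
   0. *)
case: (leqP k x) => kx.
  rewrite -natrB ?leq_mul2r; last first.
    by rewrite mulnC leq_mul2r ltnW ?orbT // ltnS leq_subr.
  congr _%:R; rewrite (mulnC (x ^_ k)) -mulnBl; congr (_ * _)%N.
  by rewrite subSn ?leq_subr // subKn.
by rewrite !ffact_small // !muln0 subrr.
Qed.

(** Newton's forward difference formula: differences at 0 recover the coefficients, so [newton] is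
    injective. *)
Lemma fdiff_newton l p : fdiff l (fun x => (newton p).[x%:R]) = l`!%:R * p`_l.
Proof.
(* The range of summation is widened so that it contains l even beyond the degree of p. *)
have pM : (size p <= maxn (size p) l.+1)%N by apply: leq_maxl.
have lM : (l < maxn (size p) l.+1)%N by apply: leq_maxr.
rewrite (newtonE pM) /fdiff.
under eq_bigr => m _.
  rewrite horner_sum mulr_sumr.
  under eq_bigr => j _ do rewrite hornerZ horner_ffact_poly mulrCA.
over.
rewrite exchange_big /= (bigD1 (Ordinal lM)) //= [X in _ + X]big1 => [|j jl].
  by rewrite -mulr_sumr addr0 -/(fdiff l (fun x => (x ^_ l)%:R)) fdiff_ffact eqxx mul1r mulrC.
rewrite -mulr_sumr -/(fdiff l (fun x => (x ^_ j)%:R)) fdiff_ffact.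
case: eqP => [lj|_]; last by rewrite mul0r mulr0.
by case/eqP: jl; apply/val_inj/esym.
Qed.

Lemma fdiff_poly_small n f : (size f <= n)%N -> fdiff n (fun x => f.[x%:R]) = 0.
Proof.
move=> fn; have [p pn <-] := newton_surj fn.
by rewrite fdiff_newton nth_default // mulr0.
Qed.

(** The difference vanishes at as many distinct naturals as its size, more than its degree allows a
    nonzero polynomial. *)
Lemma eq_poly_horner p q : (forall z, p.[z] = q.[z]) -> p = q.
Proof.
move=> pq; apply/eqP; rewrite -subr_eq0; apply/eqP.
pose rs : seq K := [seq i%:R | i <- iota 0 (size (p - q)%R)].
apply: (@roots_geq_poly_eq0 _ _ rs).
- by apply/allP => z _; rewrite rootE hornerD hornerN pq subrr.
- by rewrite map_inj_uniq ?iota_uniq // => i j /eqP; rewrite eqr_nat => /eqP.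
- by rewrite size_map size_iota.
Qed.

(** * Solving the conditions on P and on Q *)

Section Nodes.
Variables n r : nat.

Definition nodes : seq K := [seq (2 * j + r)%:R | j <- iota 0 n].

Lemma uniq_nodes : uniq nodes.
Proof.
rewrite map_inj_uniq ?iota_uniq // => i j /eqP.
by rewrite eqr_nat eqn_add2r eqn_pmul2l // => /eqP.
Qed.

Definition node_poly : {poly K} := \prod_(z <- nodes) ('X - z%:P).

Lemma size_node_poly : size node_poly = n.+1.
Proof. by rewrite size_prod_XsubC size_map size_iota. Qed.

Lemma node_poly_monic : node_poly \is monic.
Proof. exact: monic_prod_XsubC. Qed.

Lemma root_node_poly m : (m < n)%N -> node_poly.[(2 * m + r)%:R] = 0.
Proof.
move=> mn; apply/rootP; rewrite root_prod_XsubC; apply/mapP; exists m => //.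
by rewrite mem_iota.
Qed.

(** Each factor is x - r - 2i = -2 ((r - x)/2 + i). *)
Lemma horner_node_poly (x : K) :
  node_poly.[x] = (-1) ^+ n * 2 ^+ n * rising ((r%:R - x) / 2) n.
Proof.
rewrite -exprMn /rising /node_poly /nodes big_map.
have -> : iota 0 n = index_iota 0 n by rewrite /index_iota subn0.
rewrite big_mkord horner_prod -[X in _ ^+ X]card_ord -prodr_const -big_split /=.
apply: eq_bigr => i _; rewrite hornerXsubC natrD natrM mulrDr.
by rewrite mulN1r mulNr mulrCA mulfV ?pnatr_eq0 //; ring.
Qed.

(** The preimage of [node_poly] under [newton], with its coefficients read off from
    [fdiff_newton]. *)
Definition Psol : {poly K} :=
  \poly_(l < n.+1) (fdiff l (fun m => node_poly.[m%:R]) / l`!%:R).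

Lemma newton_eq_node_poly p :
  (size p <= n.+1)%N -> newton p = node_poly -> p = Psol.
Proof.
move=> pn pG; apply/polyP => l; rewrite coef_poly; case: ltnP => ln.
  by rewrite -pG fdiff_newton mulrC mulKf // pnatr_eq0 -lt0n fact_gt0.
exact: nth_default (leq_trans pn ln).
Qed.

(** Surjectivity supplies some preimage of [node_poly], and [newton_eq_node_poly] identifies it with
    [Psol]. *)
Lemma newton_Psol : newton Psol = node_poly.
Proof.
have [|p pn pG] := @newton_surj n.+1 node_poly; first by rewrite size_node_poly.
by rewrite -(newton_eq_node_poly pn pG).
Qed.

Lemma PsolP p :
  [/\ p \is monic, size p = n.+1 &
    forall m, (m < n)%N -> (newton p).[(2 * m + r)%:R] = 0] <-> p = Psol.
Proof.
split=> [[pm sp p0]|->].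
  have [gm sg] := newton_monic pm sp.
  apply: newton_eq_node_poly; rewrite ?sp // [LHS](@all_roots_prod_XsubC _ _ nodes).
  - by rewrite (monicP gm) scale1r.
  - by rewrite sg size_map size_iota.
  - apply/allP => z /mapP[m]; rewrite mem_iota => /andP[_ mn] ->.
    by rewrite rootE p0.
  - by rewrite uniq_rootsE uniq_nodes.
have Pn : (size Psol <= n.+1)%N by exact: size_poly.
(* [newton] keeps the coefficient of degree n, and [node_poly] is monic. *)
have cn : Psol`_n = 1.
  rewrite -(coef_newton Pn) newton_Psol.
  by have /monicP := node_poly_monic; rewrite /lead_coef size_node_poly.
have sn : size Psol = n.+1.
  apply/eqP; rewrite eqn_leq Pn /=.
  rewrite ltnNge; apply/negP => /leq_sizeP/(_ n (leqnn _))/eqP.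
  by rewrite cn oner_eq0.
split=> //; first by apply/monicP; rewrite /lead_coef sn.
by move=> m mn; rewrite newton_Psol root_node_poly.
Qed.

Lemma horner_Psol z : Psol.[z] = 2 ^+ n * \sum_(l < n.+1)
  (l`!%:R^-1
   * (\sum_(m < l.+1)
        (-1) ^+ (m + n + l) * 'C(l, m)%:R * rising ((r%:R - m%:R) / 2) n)
   * z ^+ l).
Proof.
rewrite horner_poly mulr_sumr; apply: eq_bigr => l _.
rewrite [in RHS]mulrA; congr (_ * _); rewrite mulrCA mulrC; congr (_ * _).
rewrite /fdiff mulr_sumr; apply: eq_bigr => m _.
rewrite horner_node_poly !exprD; ring.
Qed.

(** The factor (2l+r)! cancels the weight in [Qpair]; the sign (-1)^n and the division by (2n+r)!
    make the leading coefficient 1. *)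
Definition Qsol : {poly K} :=
  \poly_(l < n.+1) ((-1) ^+ (l + n) * 'C(n, l)%:R * (2 * l + r)`!%:R / (2 * n + r)`!%:R).

(** For q of degree at most n and f = [ffact_poly m], this is the m-th orthogonality integral of Q
    divided by M_0. A general f leaves the test polynomial free. *)
Definition Qpair (q f : {poly K}) : K :=
  \sum_(l < n.+1) q`_l / (2 * l + r)`!%:R * f.[(2 * l + r)%:R].

Let fact_neq0 k : k`!%:R != 0 :> K.
Proof. by rewrite pnatr_eq0 -lt0n fact_gt0. Qed.

Lemma coef_Qsol_n : Qsol`_n = 1.
Proof.
by rewrite coef_poly ltnSn binn mulr1 -signr_odd addnn odd_double mul1r mulfV.
Qed.

(** Up to the factor 1/(2n+r)!, the pairing is the n-th difference of l -> f(2l+r), a polynomial in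
    l of degree below n. *)
Lemma Qpair_Qsol f : (size f <= n)%N -> Qpair Qsol f = 0.
Proof.
move=> fn; pose lin : {poly K} := 2%:P * 'X + r%:R%:P.
have := @fdiff_poly_small n (f \Po lin); rewrite size_comp_poly2; last first.
  rewrite /lin size_MXaddC polyC_eq0 pnatr_eq0 /= size_polyC pnatr_eq0 //.
move=> /(_ fn) f0; rewrite -[RHS](mul0r (2 * n + r)`!%:R^-1) -f0 /Qpair /fdiff mulr_suml.
apply: eq_bigr => l _; rewrite coef_poly ltn_ord horner_comp.
have -> : lin.[l%:R] = (2 * l + r)%:R by rewrite /lin !hornerE natrD natrM.
have := fact_neq0 (2 * l + r); have := fact_neq0 (2 * n + r).
move: (_`!%:R) (_`!%:R) => a b a0 b0; field; by rewrite a0 b0.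
Qed.

(** The falling factorials of order below n span the polynomials of degree below n. *)
Lemma Qpair_newton q : (forall m, (m < n)%N -> Qpair q (ffact_poly m) = 0) ->
  forall f, (size f <= n)%N -> Qpair q f = 0.
Proof.
move=> q0 f fn; have [p pn <-] := newton_surj fn; rewrite (newtonE pn) /Qpair.
under eq_bigr do rewrite horner_sum mulr_sumr.
rewrite exchange_big big1 //= => m _.
transitivity (p`_m * Qpair q (ffact_poly m)); last by rewrite q0 ?mulr0.
rewrite /Qpair mulr_sumr.
by apply: eq_bigr => l _; rewrite hornerZ mulrCA.
Qed.

Lemma QsolP q :
  [/\ q \is monic, size q = n.+1 &
    forall m, (m < n)%N -> Qpair q (ffact_poly m) = 0] <-> q = Qsol.
Proof.
split=> [[qm sq /Qpair_newton q0]|->]; last first.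
  have Qn : (size Qsol <= n.+1)%N by exact: size_poly.
  have sn : size Qsol = n.+1.
    apply/eqP; rewrite eqn_leq Qn /=.
    rewrite ltnNge; apply/negP => /leq_sizeP/(_ n (leqnn _))/eqP.
    by rewrite coef_Qsol_n oner_eq0.
  split=> //; first by apply/monicP; rewrite /lead_coef sn coef_Qsol_n.
  by move=> m mn; rewrite Qpair_Qsol ?size_ffact_poly.
have qn : q`_n = Qsol`_n.
  by move/monicP: qm; rewrite /lead_coef sq coef_Qsol_n.
apply/polyP => k; case: (ltngtP k n) => [kn|nk|->//]; last first.
  by rewrite !nth_default ?sq ?(leq_trans (size_poly _ _)).
pose rs := rem ((2 * k + r)%:R : K) nodes.
have krs : ((2 * k + r)%:R : K) \in nodes by apply/mapP; exists k; rewrite ?mem_iota.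
(* [f] vanishes at all nodes except the [k]-th one, isolating [q`_k]. *)
pose f : {poly K} := \prod_(z <- rs) ('X - z%:P).
have fn : (size f <= n)%N.
  rewrite size_prod_XsubC size_rem // size_map size_iota prednK //.
  exact: leq_ltn_trans kn.
(* Only the terms l = k and l = n can survive, as 2n + r is not a node. The latter is the same for q
   and [Qsol] by [qn], so comparing the pairings isolates the k-th coefficients. *)
have pairk p : p`_n = q`_n ->
    Qpair p f = p`_k / (2 * k + r)`!%:R * f.[(2 * k + r)%:R]
      + q`_n / (2 * n + r)`!%:R * f.[(2 * n + r)%:R].
  move=> pq; rewrite /Qpair big_ord_recr /= pq; congr (_ + _).
  rewrite (bigD1 (Ordinal kn)) //= big1 ?addr0 // => l lk.
  rewrite (_ : f.[_] = 0) ?mulr0 //; apply/rootP; rewrite root_prod_XsubC.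
  rewrite mem_rem_uniq ?uniq_nodes // inE; apply/andP; split.
    by rewrite eqr_nat eqn_add2r eqn_pmul2l // -val_eqE.
  by apply/mapP; exists (val l); rewrite ?mem_iota /=.
have := etrans (q0 f fn) (esym (Qpair_Qsol fn)); rewrite !pairk // => /addIr.
have fk : f.[(2 * k + r)%:R] != 0.
  by rewrite -rootE root_prod_XsubC mem_rem_uniq ?uniq_nodes // inE eqxx.
by move=> /(mulIf fk) /(mulIf (invr_neq0 (fact_neq0 _))).
Qed.
End Nodes.

(** * Rising factorials in terms of factorials *)

Lemma rising_opp_nat n l : rising (- n%:R) l = (-1) ^+ l * (n ^_ l)%:R :> K.
Proof.
elim: l => [|l IH]; first by rewrite /rising big_ord0 mulr1.
rewrite /rising big_ord_recr /= -/(rising _ _) IH ffactnSr natrM exprS.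
case: (leqP l n) => [ln|nl]; first by rewrite natrB //; ring.
by rewrite ffact_small // !mul0r !mulr0 mul0r.
Qed.

(** Each step multiplies both sides by (2l+r+1)(2l+r+2) = 4 ((r+1)/2 + l)((r+2)/2 + l). *)
Lemma rising_half_fact r l :
  4 ^+ l * rising ((r%:R + 1) / 2) l * rising ((r%:R + 2) / 2) l
  = (2 * l + r)`!%:R / r`!%:R :> K.
Proof.
have r0 : r`!%:R != 0 :> K by rewrite pnatr_eq0 -lt0n fact_gt0.
elim: l => [|l IH]; first by rewrite /rising !big_ord0 !mulr1 add0n mulfV.
rewrite (_ : 2 * l.+1 + r = (2 * l + r).+2)%N; last by rewrite mulnS.
have e1 : (2 * l + r).+1%:R = 2 * l%:R + r%:R + 1 :> K by rewrite -addn1 2!natrD natrM.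
have e2 : (2 * l + r).+2%:R = 2 * l%:R + r%:R + 2 :> K by rewrite -addn2 2!natrD natrM.
rewrite !factS !natrM e1 e2 -!mulrA -IH /rising !big_ord_recr /= exprS.
by field.
Qed.
End Newton.

(** * The hypergeometric form of Q *)

Section Hypergeometric.
Variable K : numFieldType.

(** The terms vanish beyond n, so the partial sums are eventually constant, and (-n)_l / l! = (-1)^l
    binomial(n, l). *)
Lemma hyp3F0_opp_nat n (b c x : K) :
  hyp3F0 (- n%:R) b c x =
  \sum_(l < n.+1) (-1) ^+ l * 'C(n, l)%:R * rising b l * rising c l * x ^+ l.
Proof.
rewrite /hyp3F0; set u := fun l : nat => _.
have u0 l : (n < l)%N -> u l = 0.
  by move=> nl; rewrite /u rising_opp_nat ffact_small // mulr0 !mul0r.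
have -> : limn (series u) = series u n.+1.
  apply: lim_near_cst; first exact: norm_hausdorff.
  near=> N; have nN : (n.+1 <= N)%N by near: N; exact: nbhs_infty_ge.
  rewrite /series /= (@big_cat_nat _ _ _ n.+1) //= [X in _ + X]big_nat_cond.
  by rewrite [X in _ + X]big1 ?addr0 // => l /andP[/andP[nl _] _]; exact: u0.
rewrite /series /= big_mkord; apply: eq_bigr => l _.
rewrite /u rising_opp_nat -bin_ffact natrM; have := fact_gt0 l.
by rewrite -(ltr0n K) => /lt0r_neq0 l0; field.
Unshelve. all: by end_near.
Qed.

(** [rising_half_fact], used at l and at n, relates the factorials of [Qsol] to rising factorials;
    r! cancels and 4^l is absorbed into (4z)^l. *)
Lemma horner_Qsol n r (z : K) :
  (Qsol K n r).[z] = (-1) ^+ n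
    / (4 ^+ n * rising ((r%:R + 1) / 2) n * rising ((r%:R + 2) / 2) n)
    * hyp3F0 (- n%:R) ((r%:R + 1) / 2) ((r%:R + 2) / 2) (4 * z).
Proof.
rewrite hyp3F0_opp_nat rising_half_fact horner_poly mulr_sumr.
have fact_neq0 k : k`!%:R != 0 :> K by rewrite pnatr_eq0 -lt0n fact_gt0.
apply: eq_bigr => l _; have := rising_half_fact K r l.
set b := rising _ l; set c := rising _ l => bcE.
have {bcE} -> : (2 * l + r)`!%:R = r`!%:R * (4 ^+ l * b * c).
  by rewrite bcE mulrC divfK.
rewrite exprMn exprD; have := fact_neq0 r; have := fact_neq0 (2 * n + r)%N.
by move: (_`!%:R) (_`!%:R) => d e d0 e0; field; rewrite d0 e0.
Qed.
End Hypergeometric.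

(** * Identification of P and Q *)

Section Orthogonality.
Variable R : realType.
Implicit Types (p q : {poly R[i]}).

Lemma moment0_neq0 : moment R 0 != 0.
Proof. by apply/eqP => m0; have := Re_moment0_gt0 R; rewrite m0 ltxx. Qed.

(** With x = 2m + r, [moment_ffact] turns z^l into the falling factorial of x of order l, whence
    [newton p] at x. *)
Lemma circle_mean_P p m r :
  circle_mean (fun zeta => p.[zeta] * zeta ^ (- 2 * m%:Z - r%:Z) * expC zeta)
  = moment R 0 / (2 * m + r)`!%:R * (newton p).[(2 * m + r)%:R].
Proof.
rewrite (@circle_mean_sum _ (size p) (fun l => p`_l)
  (fun l => l%:Z - (2 * m + r)%:Z)) => [|z z0].
  rewrite horner_sum mulr_sumr; apply: eq_bigr => l _.
  by rewrite moment_ffact hornerZ horner_ffact_poly; ring.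
rewrite horner_coef mulr_suml; congr (_ * _); apply: eq_bigr => l _.
rewrite -mulrA exprnP -expfzDr //; congr (_ * _ ^ _).
by rewrite PoszD PoszM; ring.
Qed.

(** The roles are swapped: the exponents are m - (2l+r), so the order m of the falling factorial is
    fixed and the summation index enters its argument. *)
Lemma circle_mean_Q n r q m : (size q <= n.+1)%N ->
  circle_mean (fun zeta => q.[zeta ^- 2] * zeta ^ (m%:Z - r%:Z) * expC zeta)
  = moment R 0 * Qpair n r q (ffact_poly _ m).
Proof.
move=> qn; rewrite (@circle_mean_sum _ n.+1 (fun l => q`_l)
  (fun l => m%:Z - (2 * l + r)%:Z)) => [|z z0].
  rewrite mulr_sumr; apply: eq_bigr => l _.
  by rewrite moment_ffact horner_ffact_poly; ring.
rewrite (horner_coef_wide _ qn) mulr_suml; congr (_ * _); apply: eq_bigr => l _.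
rewrite -mulrA -exprVn -exprM exprVn exprnN -expfzDr //; congr (_ * _ ^ _).
by rewrite PoszD PoszM; ring.
Qed.

Lemma is_P_expC n r p : is_P expC n r p <-> p = Psol _ n r.
Proof.
rewrite -PsolP; split=> -[pm sp p0]; split=> // m mn; have := p0 m mn.
  rewrite circle_mean_P => /eqP; rewrite mulf_eq0 => /orP[|/eqP //].
  by rewrite mulf_eq0 (negPf moment0_neq0) invr_eq0 pnatr_eq0 -leqn0 leqNgt fact_gt0.
by rewrite circle_mean_P => ->; rewrite mulr0.
Qed.

Lemma is_Q_expC n r q : is_Q expC n r q <-> q = Qsol _ n r.
Proof.
rewrite -QsolP; split=> -[qm sq q0]; split=> // m mn; have := q0 m mn.
  rewrite (@circle_mean_Q n) ?sq // => /eqP.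
  by rewrite mulf_eq0 (negPf moment0_neq0) => /eqP.
by rewrite (@circle_mean_Q n) ?sq // => ->; rewrite mulr0.
Qed.
End Orthogonality.

Unset Implicit Arguments.

Theorem lemma7p2 (R : realType) (n r : nat) :
  (forall p : {poly R[i]},
    is_P expC n r p <->
    forall z : R[i],
      p.[z] = 2 ^+ n * \sum_(l < n.+1)
        (l`!%:R^-1
         * (\sum_(m < l.+1)
              (-1) ^+ (m + n + l) * 'C(l, m)%:R * rising ((r%:R - m%:R) / 2) n)
         * z ^+ l))
  /\
  (forall q : {poly R[i]},
    is_Q expC n r q <->
    forall z : R[i],
      q.[z] = (-1) ^+ n
              / (4 ^+ n * rising ((r%:R + 1) / 2) n * rising ((r%:R + 2) / 2) n)
              * hyp3F0 (- n%:R) ((r%:R + 1) / 2) ((r%:R + 2) / 2) (4 * z)).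
Proof.
split=> p.
- rewrite is_P_expC; split=> [-> z|pE]; first exact: horner_Psol.
  by apply: eq_poly_horner => z; rewrite pE horner_Psol.
- rewrite is_Q_expC; split=> [-> z|qE]; first exact: horner_Qsol.
  by apply: eq_poly_horner => z; rewrite qE horner_Qsol.
Qed.
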